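(* Let $G$ be a finitely generated group acting on the real line $\mathbb{R}$ by order preserving homeomorphisms. Suppose there is a point $p\in\mathbb{R}$ whose stabilizer $\mathrm{Stab}_G(p)=\{g\in G\mid g(p)=p\}$ is a proper and co-amenable subgroup of $G$. Then there is a surjective group homomorphism $G\to\mathbb{Z}$.
   Context: A subgroup $H\leq G$ of a (discrete) group $G$ is co-amenable if whenever $G$ acts by homeomorphisms on a compact (Hausdorff) space $X$ in such a way that $H$ preserves a (regular Borel) probability measure on $X$, then $G$ also preserves a (regular Borel) probability measure on $X$. *)

(* Defs.v *)
From HB Require Import structures.
From mathcomp Require Import all_boot all_order all_algebra.
From mathcomp Require Import all_classical all_reals all_analysis.

Set Implicit Arguments.
Unset Strict Implicit.
Unset Printing Implicit Defensive.

Import Order.TTheory GRing.Theory Num.Theory.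
Import numFieldNormedType.Exports.

Local Open Scope classical_set_scope.
Local Open Scope ring_scope.

Definition subgroup (G : groupType) (H : set G) : Prop := group_closed (mem H).

Definition finitely_generated (G : groupType) : Prop :=
  exists2 A : set G, finite_set A & smallest (@subgroup G) A = [set: G].

(* Left actions of possibly infinite groups. *)
Definition group_action (G : groupType) (X : Type) (act : G -> X -> X) : Prop :=
  (forall x, act 1%g x = x) /\
  (forall g h x, act (g * h)%g x = act g (act h x)).

Definition stabilizer (G : groupType) (X : Type) (act : G -> X -> X) (p : X) :
  set G := [set g | act g p = p].

Definition homeomorphism (X : topologicalType) (f : X -> X) : Prop :=
  exists f' : X -> X,
    [/\ cancel f f', cancel f' f, continuous f & continuous f'].

Definition acts_by_homeomorphisms (G : groupType) (X : topologicalType)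
    (act : G -> X -> X) : Prop :=
  group_action act /\ forall g, homeomorphism (act g).

Definition borel (X : ptopologicalType) := g_sigma_algebraType (@open X).

Definition regular_measure (R : realType) (X : ptopologicalType)
    (mu : probability (borel X) R) : Prop :=
  forall A : set (borel X), measurable A ->
    mu A = ereal_inf [set mu U | U in [set U : set X | open U /\ A `<=` U]] /\
    mu A = ereal_sup [set mu K | K in
             [set K : set X | [/\ compact K, measurable (K : set (borel X))
                                & K `<=` A]]].

Definition preserves_measure (R : realType) (G : groupType)
    (X : ptopologicalType) (act : G -> X -> X) (H : set G)
    (mu : probability (borel X) R) : Prop :=
  forall g, H g -> forall A : set (borel X), measurable A ->
    mu (act g @^-1` A) = mu A.

(* Requiring X to be pointed only excludes the empty space, which carries no
   probability measure. *)
Definition coamenable (R : realType) (G : groupType) (H : set G) : Prop :=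
  subgroup H /\
  forall (X : ptopologicalType) (act : G -> X -> X),
    compact [set: X] -> hausdorff_space X -> acts_by_homeomorphisms act ->
    (exists mu : probability (borel X) R,
       regular_measure mu /\ preserves_measure act H mu) ->
    exists mu : probability (borel X) R,
      regular_measure mu /\ preserves_measure act [set: G] mu.

(* Main.v *)
Require Import Defs.
From HB Require Import structures.
From mathcomp Require Import all_boot all_order all_algebra.
From mathcomp Require Import all_classical all_reals all_analysis.
From mathcomp Require Import zify ring lra.

Set Implicit Arguments.
Unset Strict Implicit.
Unset Printing Implicit Defensive.

Import Order.TTheory GRing.Theory Num.Theory.
Import numFieldNormedType.Exports.

Local Open Scope classical_set_scope.
Local Open Scope ring_scope.

(* Applied to the space of ultrafilters on the orbit of [p], co-amenability gives
   a [G]-invariant finitely additive mean on the subsets of the orbit. If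
   [x <= f x], [x <= g x] and [f g g x < g x], then [x] never comes back to this
   configuration under the powers of [f g]; hence such crossings form a null set,
   and so do their mirror images. Along an ultrafilter containing all sets of
   mean 1, comparing [a x] with [b x] defines a left-invariant total preorder on
   [G] without crossings (a Conradian one). It is nontrivial because at each
   point of the orbit one of the finitely many generators moves the point.

   For such a preorder, a power of the largest generator has cofinal powers. The
   elements whose powers are not cofinal upwards are closed under products, so
   that [g <= h] iff the powers of [h^-1 g] are not cofinal upwards defines a
   bi-invariant total preorder with an order unit. Hoelder's argument turns it
   into a nonzero homomorphism to the reals, and a finitely generated nonzero
   subgroup of the reals maps onto the integers. *)

(** * Stone-Cech compactification of a discrete set *)

Lemma ultra_dichotomy (T : Type) (F : set_system T) :
  ProperFilter F -> (forall A, F A \/ F (~` A)) -> UltraFilter F.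
Proof.
move=> FF FVC; split => // G GF FG; apply/seteqP; split => // A GA.
have [//|/FG GA'] := FVC A.
by have /filter_ex[x []] : G (A `&` ~` A) by exact: filterI.
Qed.

(* The base point [p] only serves to equip the type with a canonical point. *)
Definition stone_cech (T : Type) (p : T) : Type :=
  {U : set_system T | UltraFilter U}.

Section StoneCech.
Variables (T : Type) (p : T).
Local Notation beta := (stone_cech p).
Implicit Types (A B : set T) (w : beta).

HB.instance Definition _ := gen_eqMixin beta.
HB.instance Definition _ := gen_choiceMixin beta.
HB.instance Definition _ := isPointed.Build beta
  (exist _ (principal_filter p) (principal_filter_ultra p)).

Definition stone_basic A : set beta := [set w | sval w A].

Lemma stone_ultra w : UltraFilter (sval w).
Proof. exact: svalP. Qed.

Lemma stone_proper w : ProperFilter (sval w).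
Proof. by have [] := stone_ultra w. Qed.

Lemma stone_basicT : stone_basic setT = setT.
Proof.
apply/seteqP; split => // w _; have := stone_proper w => ?; exact: filterT.
Qed.

Lemma stone_basicI A B :
  stone_basic (A `&` B) = stone_basic A `&` stone_basic B.
Proof.
apply/seteqP; split => w /=; have := stone_proper w => ?.
  by move=> wAB; split; apply: filterS wAB => x [].
by move=> [wA wB]; exact: filterI.
Qed.

Lemma stone_basic0 : stone_basic set0 = set0.
Proof.
by apply/seteqP; split => // w /=; have := stone_proper w => ? /filter_ex[].
Qed.

Lemma stone_basicC A : stone_basic (~` A) = ~` stone_basic A.
Proof.
apply/seteqP; split => w /=.
  move=> wA wA'; suff : stone_basic set0 w by rewrite stone_basic0.
  by rewrite -(setICr A) stone_basicI.
by move=> nA; have [] := in_ultra_setVsetC A (stone_ultra w).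
Qed.

Lemma stone_basicU A B :
  stone_basic (A `|` B) = stone_basic A `|` stone_basic B.
Proof.
by rewrite -[A `|` B]setCK setCU stone_basicC stone_basicI !stone_basicC setCI !setCK.
Qed.

Lemma stone_basic_cover : \bigcup_(A in setT) stone_basic A = setT.
Proof.
apply/seteqP; split => // w _; exists setT; rewrite ?stone_basicT //.
Qed.

Lemma stone_basic_join A B w : setT A -> setT B ->
  stone_basic A w -> stone_basic B w ->
  exists C, [/\ setT C, stone_basic C w &
    stone_basic C `<=` stone_basic A `&` stone_basic B].
Proof. by move=> _ _ wA wB; exists (A `&` B); rewrite stone_basicI; split. Qed.

HB.instance Definition _ :=
  isBaseTopological.Build beta stone_basic_cover stone_basic_join.

Lemma open_stoneP (O : set beta) :
  open O <-> forall w, O w -> exists2 A, sval w A & stone_basic A `<=` O.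
Proof.
split=> [[D _ <-] w [A DA wA]|OP].
  by exists A => //; exact: bigcup_sup.
exists [set A | stone_basic A `<=` O] => //.
apply/seteqP; split => [w [A AO /AO//]|w /OP[A wA AO]]; by exists A.
Qed.

Lemma open_stone_basic A : open (stone_basic A).
Proof. by apply/open_stoneP => w wA; exists A. Qed.

(** An ultrafilter [F] on the space converges to the ultrafilter of those [A] whose basic set
    belongs to [F]. *)
Lemma stone_compact : compact [set: beta].
Proof.
rewrite compact_ultra => F FU _.
pose W := [set A | F (stone_basic A)].
have WF : ProperFilter W.
  apply: Build_ProperFilter_ex.
    move=> A FA; have [w wA] := @filter_ex _ F _ _ FA.
    by have := stone_proper w => ?; exact: filter_ex wA.
  split.
  - by rewrite /W /= stone_basicT; exact: filterT.
  - by move=> A B; rewrite /W /= stone_basicI; exact: filterI.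
  - move=> A B AB; rewrite /W /=; apply: filterS => w.
    have := stone_proper w => ?; exact: filterS.
have WU : UltraFilter W.
  apply: ultra_dichotomy => A; rewrite /W /= stone_basicC.
  exact: in_ultra_setVsetC.
exists (exist _ W WU); split => // N /=.
rewrite nbhsE => -[V [oV VW] VN]; apply: filterS VN _.
by have [A] := (open_stoneP V).1 oV _ VW; rewrite /= /W /= => FA AV; apply: filterS FA.
Qed.

Lemma stone_ext w w' : sval w = sval w' -> w = w'.
Proof.
case: w w' => [U HU] [U' HU'] /= UU'; subst U'.
by congr exist; exact: Prop_irrelevance.
Qed.

Lemma stone_hausdorff : hausdorff_space beta.
Proof.
rewrite open_hausdorff => w w' /eqP ww'.
have [A [wA w'A]] : exists A, sval w A /\ ~ sval w' A.
  apply: contra_notP ww' => /forallNP ww'; apply: stone_ext.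
  apply: (@max_filter _ _ (stone_ultra w')); first exact: stone_proper.
  move=> A w'A; have [//|wA] := in_ultra_setVsetC A (stone_ultra w).
  suff : stone_basic (A `&` ~` A) w' by rewrite setICr stone_basic0.
  by rewrite stone_basicI; split => //; apply: contrapT => nA; apply: (ww' (~` A)).
exists (stone_basic A, stone_basic (~` A)); split => /=.
- exact/mem_set.
- by apply/mem_set; rewrite stone_basicC.
- exact: open_stone_basic.
- exact: open_stone_basic.
- by apply/eqP; rewrite -stone_basicI setICr stone_basic0.
Qed.

Lemma measurable_stone_basic A :
  measurable (stone_basic A : set (borel beta)).
Proof. by apply: sub_sigma_algebra; exact: open_stone_basic. Qed.

End StoneCech.

Section StoneMap.
Variables (T : Type) (p : T).

Lemma stone_map_ultra (f : T -> T) (w : stone_cech p) :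
  UltraFilter [set A | sval w (f @^-1` A)].
Proof.
have wF := stone_proper w; have wU := stone_ultra w.
by apply: ultra_dichotomy => A; exact: (in_ultra_setVsetC (f @^-1` A) wU).
Qed.

(** The continuous extension of [f], realized as push-forward of ultrafilters. *)
Definition stone_map (f : T -> T) (w : stone_cech p) : stone_cech p :=
  exist _ _ (stone_map_ultra f w).

Lemma stone_map_continuous (f : T -> T) : continuous (stone_map f).
Proof.
apply/continuousP => O /open_stoneP oO; apply/open_stoneP => w /oO[A wA AO].
by exists (f @^-1` A) => // w' w'A; apply: AO.
Qed.

Lemma stone_map_action (G : groupType) (act : G -> T -> T) :
  group_action act ->
  acts_by_homeomorphisms (fun g => stone_map (act g)).
Proof.
move=> [act1 actM].
have sact : group_action (fun g => stone_map (act g)).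
  split=> [w|g h w]; apply: stone_ext; apply/funext => A /=; congr (sval w _).
    by apply/funext => x /=; rewrite act1.
  by apply/funext => x /=; rewrite actM.
split=> // g; exists (stone_map (act g^-1%g)); split; last 2 first.
- exact: stone_map_continuous.
- exact: stone_map_continuous.
- by move=> w; rewrite -sact.2 mulVg sact.1.
- by move=> w; rewrite -sact.2 mulgV sact.1.
Qed.

End StoneMap.

(** * From co-amenability to an invariant mean *)

Lemma regular_dirac (R : realType) (X : ptopologicalType) (x : X) :
  hausdorff_space X ->
  regular_measure (\d_(x : borel X) : probability (borel X) R).
Proof.
move=> hX A mA; have cx : closed [set x].
  by exact/accessible_closed_set1/hausdorff_accessible.
have mx : measurable ([set x] : set (borel X)).
  rewrite -[[set x]]setCK; apply: measurableC; apply: sub_sigma_algebra.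
  exact: closed_openC.
have dE (B : set (borel X)) : (\d_(x : borel X) : probability (borel X) R) B =
  (x \in B)%:R%:E by exact: diracE.
(* Both bounds are attained: from outside by the whole space or the complement of [x], from inside
   by the singleton of [x] or the empty set. *)
rewrite !dE; split; apply/eqP; rewrite eq_le; apply/andP; split.
- apply: le_ereal_inf_tmp => _ [U [_ AU] <-]; rewrite dE lee_fin.
  by case: (boolP (x \in A)) => // /set_mem /AU /mem_set ->.
- apply: ereal_inf_lbound; case: (boolP (x \in A)) => xA.
    by exists setT; [split; [exact: openT|]|rewrite dE in_setT].
  exists (~` [set x]); last first.
    by rewrite dE memNset//= => /(_ erefl).
  split; first exact: closed_openC.
  by move=> y Ay xy; move: xA; rewrite -xy mem_set.
- apply: ereal_sup_ubound; case: (boolP (x \in A)) => xA.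
    exists [set x]; last by rewrite dE mem_set.
    by split => [|//|y ->]; [exact: compact_set1|exact: set_mem].
  exists set0; last by rewrite dE memNset.
  by split; [exact: compact0|exact: measurable0|].
- apply: ge_ereal_sup => _ [K [_ _ KA] <-]; rewrite dE lee_fin.
  by case: (boolP (x \in K)) => // /set_mem /KA /mem_set ->.
Qed.

Definition invariant_mean (R : realType) (G : groupType) (T : Type)
    (act : G -> T -> T) (m : set T -> R) : Prop :=
  [/\ m setT = 1, forall A, 0 <= m A,
      forall A B, A `&` B = set0 -> m (A `|` B) = m A + m B
    & forall g A, m (act g @^-1` A) = m A].

(** [H] fixes the principal ultrafilter at [p], so its Dirac mass is an [H]-invariant regular
    measure. The [G]-invariant measure that co-amenability then gives is evaluated on the basic
    clopen sets, where only finite additivity remains. *)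
Lemma coamenable_mean (R : realType) (G : groupType) (H : set G) (T : Type)
    (act : G -> T -> T) (p : T) :
  group_action act -> (forall h, H h -> act h p = p) -> coamenable R H ->
  exists m : set T -> R, invariant_mean act m.
Proof.
move=> actG Hp [_ coH].
pose sact g : stone_cech p -> stone_cech p := stone_map (act g).
have [] := coH (stone_cech p) sact.
- exact: stone_compact.
- exact: stone_hausdorff.
- exact: stone_map_action.
- exists (\d_(point : borel (stone_cech p))); split.
    by apply: regular_dirac; exact: stone_hausdorff.
  move=> h Hh A mA.
  have E : sact h point = point.
    apply: stone_ext; apply/seteqP; split => B;
    rewrite /= !principal_filterP /= (Hp _ Hh) //.
  rewrite /= !diracE; congr ((nat_of_bool _)%:R%:E).
  by apply/idP/idP; rewrite !inE /= E.
move=> mu [_ muG].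
pose B A : set (borel (stone_cech p)) := @stone_basic _ p A.
have mB A : measurable (B A) by exact: measurable_stone_basic.
exists (fun A => fine (mu (B A))); split.
- by rewrite /B stone_basicT probability_setT.
- by move=> A; exact: fine_ge0.
- move=> A A' AA'; rewrite /B stone_basicU measureU ?fineD//.
  + exact: fin_num_measure.
  + exact: fin_num_measure.
  + by rewrite -stone_basicI AA' stone_basic0.
- by move=> g A; rewrite -(muG g Logic.I (B A)).
Qed.

(** * Left-invariant total preorders *)

Definition left_preorder (G : groupType) (le : G -> G -> Prop) : Prop :=
  [/\ forall a b, le a b \/ le b a,
      forall b a c, le a b -> le b c -> le a c
    & forall c a b, le a b -> le (c * a)%g (c * b)%g].

(** Conrad's condition [g <= f g g] for nonnegative [f] and [g]. For a left-invariant [le],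
    conjugation by [y] reduces it to [y = 1]; the base point is kept so that it applies directly
    along any orbit. *)
Definition crossing_free (G : groupType) (le : G -> G -> Prop) : Prop :=
  forall f g y, le y (f * y)%g -> le y (g * y)%g ->
    le (g * y)%g (f * (g * (g * y)))%g.

Section LeftPreorder.
Variables (G : groupType) (le : G -> G -> Prop).
Hypothesis le_pre : left_preorder le.
Implicit Types (a b c s y : G).

Local Open Scope group_scope.
Local Notation lt a b := (~ le b a).

Lemma pre_total a b : le a b \/ le b a. Proof. by case: le_pre. Qed.

Lemma pre_trans b a c : le a b -> le b c -> le a c.
Proof. by case: le_pre => _ h _; exact: h. Qed.

Lemma pre_mul c a b : le a b -> le (c * a) (c * b).
Proof. by case: le_pre => _ _; exact. Qed.

Lemma pre_refl a : le a a. Proof. by case: (pre_total a a). Qed.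

Lemma pre_ltW a b : lt a b -> le a b.
Proof. by case: (pre_total a b). Qed.

Lemma pre_mulV c a b : le (c * a) b -> le a (c^-1 * b).
Proof. by move=> /(pre_mul c^-1); rewrite mulKg. Qed.

Lemma pre_Vmul c a b : le a (c * b) -> le (c^-1 * a) b.
Proof. by move=> /(pre_mul c^-1); rewrite mulKg. Qed.

Lemma pre_mulI c a b : le (c * a) (c * b) -> le a b.
Proof. by move=> /pre_mulV; rewrite mulKg. Qed.

Lemma pre_lt_mul c a b : lt a b -> lt (c * a) (c * b).
Proof. by move=> ab /pre_mulI. Qed.

Lemma pre_le_lt_trans b a c : le a b -> lt b c -> lt a c.
Proof. by move=> ab bc ca; apply: bc; apply: pre_trans ab. Qed.

Lemma pre_lt_le_trans b a c : lt a b -> le b c -> lt a c.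
Proof. by move=> ab bc ca; apply: ab; apply: pre_trans ca. Qed.

Lemma pre_lt_trans b a c : lt a b -> lt b c -> lt a c.
Proof. by move=> ab /pre_ltW; exact: pre_lt_le_trans. Qed.

Lemma pre_expg s y n : le y (s * y) -> le y (s ^+ n * y).
Proof.
move=> sy; elim: n => [|n IHn]; first by rewrite mul1g; exact: pre_refl.
by apply: pre_trans sy _; rewrite expgS -mulgA; exact: pre_mul.
Qed.

Lemma pre_expg_le s y m n : le y (s * y) -> (m <= n)%N ->
  le (s ^+ m * y) (s ^+ n * y).
Proof.
move=> sy /subnKC <-; rewrite expgnDr -mulgA; apply: pre_mul.
exact: pre_expg.
Qed.

End LeftPreorder.

Lemma left_preorder_rev (G : groupType) (le : G -> G -> Prop) :
  left_preorder le -> left_preorder (fun a b => le b a).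
Proof.
move=> [le_total le_trans leM]; split=> [a b|b a c ab bc|c a b ab].
- by case: (le_total a b); [right|left].
- exact: le_trans ab.
- exact: leM.
Qed.

(** * Dynamics of crossing-free preorders *)

Section Conradian.
Variables (G : groupType) (le : G -> G -> Prop).
Hypotheses (le_pre : left_preorder le) (le_free : crossing_free le).
Implicit Types (a b c f g q r s t v x y z : G).

Local Open Scope group_scope.
Local Notation lt a b := (~ le b a).
Let leM := pre_mul le_pre.
Let leT := pre_trans le_pre.
Let ltW := pre_ltW le_pre.
Let leX := pre_expg le_pre.

(* The gain per step comes from crossing-freeness: with [w = s^-1 v], it gives
   [v ^+ j y <= w v ^+ 2j y], that is [s v ^+ j y <= v ^+ (2j+1) y]. *)
Lemma dominated_powers s v y : le y (s * y) -> le (s * y) (v * y) ->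
  forall n, exists N, le (s ^+ n * y) (v ^+ N * y).
Proof.
move=> sy sv; have vy := leT sy sv; pose w := s^-1 * v.
have wy : le y (w * y) by rewrite -mulgA; exact: (pre_mulV le_pre).
have step j : le (s * (v ^+ j * y)) (v ^+ (j + j).+1 * y).
  have := leM s (le_free wy (leX j vy)).
  by rewrite /w -!mulgA mulVKg expgS expgnDr -!mulgA.
elim=> [|n [N IHn]]; first by exists 0%N; rewrite !expg0; exact: (pre_refl le_pre).
exists (N + N).+1; apply: leT (step N); rewrite expgS -mulgA; exact: leM.
Qed.

(** If [q s^(k+1) y <= s^k y], the conjugate [v = s^-k q^-1 s^k] satisfies [s y <= v y], so some
    [v^N y] is at least [s^(k+1) y], that is [q^N s^k s^(k+1) y <= s^k y]. Crossing-freeness for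
    [q^N] and [s^k] says [s^k y <= q^N s^k s^k y], a contradiction. *)
Lemma weak_commutation s q y : lt y (s * y) -> le y (q * y) ->
  forall k, lt (s ^+ k * y) (q * (s ^+ k.+1 * y)).
Proof.
move=> sy qy k qk; pose v := s ^- k * (q^-1 * s ^+ k).
have [||N] := @dominated_powers s v y _ _ k.+1; first exact: ltW.
  rewrite /v -!mulgA; apply: (pre_mulV le_pre); apply: (pre_mulV le_pre).
  by move: qk; rewrite expgSr -!mulgA.
have -> : v ^+ N = s ^- k * (q ^- N * s ^+ k).
  have := conjXg q^-1 (s ^+ k) N.
  by rewrite /conjg expVgn => ->.
rewrite -!mulgA => h; have {}h := leM (q ^+ N) (leM (s ^+ k) h).
move: h; rewrite !mulVKg.
change (lt (s ^+ k * y) (q ^+ N * (s ^+ k * (s ^+ k.+1 * y)))).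
apply: (pre_le_lt_trans le_pre (le_free (leX N qy) (leX k (ltW sy)))).
do 2!apply: (pre_lt_mul le_pre); rewrite expgSr -mulgA.
exact: (pre_lt_mul le_pre).
Qed.

(** The elements [g] such that every [g t^n] lies below a power of [t] form a monoid [K]; since it
    contains [A] and its inverses, it contains the generated subgroup. *)
Lemma generator_powers_bounded (A : set G) t :
  le 1 t -> (forall a, A a -> le a t /\ le a^-1 t) ->
  forall g, smallest (@subgroup G) A g -> exists n, le g (t ^+ n).
Proof.
move=> t1 At g Ag.
pose K := [set g | forall n, exists N, le (g * t ^+ n) (t ^+ N)].
have tX n : le 1 (t ^+ n) by rewrite -[t ^+ n]mulg1; apply: leX; rewrite mulg1.
have KM a b : K a -> K b -> K (a * b).
  move=> Ka Kb n; have [m bm] := Kb n; have [N aN] := Ka m.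
  by exists N; apply: leT aN; rewrite -mulgA; exact: leM.
have KA b : le b t -> K b.
  (* If [t^(2n+3) < b t^n], then [f = t b^-1 t] and [t^(n+1)] are nonnegative but
     [f t^(2n+2) < t^(n+1)], which is a crossing at [1]. *)
  move=> bt n; exists (n.+1 + n.+2)%N; apply: contrapT => tb.
  pose f := t * (b^-1 * t).
  have f1 : le 1 (f * 1).
    rewrite mulg1; apply: leT t1 _; rewrite -{1}[t]mulg1; apply: leM.
    by apply: (pre_mulV le_pre); rewrite mulg1.
  have tn1 : le 1 (t ^+ n.+1 * 1) by rewrite mulg1.
  have := le_free f1 tn1; rewrite !mulg1.
  suff : lt (f * (t ^+ n.+1 * t ^+ n.+1)) (t ^+ n.+1) by [].
  rewrite /f expgS -!mulgA; apply: (pre_lt_mul le_pre).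
  move=> /(leM b); rewrite mulVKg => h; apply: tb.
  by rewrite addnS addSn !expgS expgnDr; move: h; rewrite !expgS.
have [] : [set g | K g /\ K g^-1] g => //.
apply: Ag; split; last by move=> a /At[? ?]; split; apply: KA.
split=> [|a b]; rewrite !inE => /=.
  by rewrite invg1; split=> n; exists n; rewrite mul1g; exact: (pre_refl le_pre).
by move=> [Ka Ka'] [Kb Kb']; rewrite invgF; split; apply: KM; rewrite ?invgK.
move=> /(_ 0%N)[N gN] _; exists N; by rewrite expg0 mulg1 in gN.
Qed.

Section Cofinal.
Variable s : G.
Hypothesis s_gt1 : lt 1 s.
Hypothesis s_cofinal : forall g, exists n, le (s ^- n) g /\ le g (s ^+ n).

(** With [s^-n <= y <= s^m], having [s y <= y] would give [s^(m+1) <= s^(n+m+1) y <= y <= s^m]. *)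
Lemma cofinal_gt y : lt y (s * y).
Proof.
have [n [sy _]] := s_cofinal y; have [m [_ ys]] := s_cofinal y.
move=> sy1.
have yX k : le (s ^+ k * y) y by apply: (pre_expg (left_preorder_rev le_pre)).
have := yX (n + m.+1)%N; rewrite addnC expgnDr -mulgA.
have /(leM (s ^+ n)) := sy; rewrite mulgV => /(leM (s ^+ m.+1)); rewrite mulg1.
move=> h /(leT h) /leT /(_ ys); rewrite expgSr -{2}[s ^+ m]mulg1.
by move=> /(pre_mulI le_pre).
Qed.

Lemma cofinal_floor y z : le y z ->
  exists k, le (s ^+ k * y) z /\ lt z (s ^+ k.+1 * y).
Proof.
move=> yz; have [m [sy _]] := s_cofinal y; have [n [_ zs]] := s_cofinal z.
have [N] : exists N, lt z (s ^+ N * y).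
  exists (n.+1 + m)%N; apply: (pre_le_lt_trans le_pre zs).
  rewrite expgnDr -mulgA; apply: (pre_lt_le_trans le_pre (b := s ^+ n.+1)).
    by rewrite expgSr -{2}[s ^+ n]mulg1; apply: (pre_lt_mul le_pre).
  rewrite -{1}[s ^+ n.+1]mulg1; apply: leM; move: (leM (s ^+ m) sy).
  by rewrite mulgV.
elim: N => [|N IHN] zN; first by rewrite mul1g in zN.
by have [/IHN//|/contrapT] := pselect (lt z (s ^+ N * y)); exists N.
Qed.

(** Locate [z] between [s^k y] and [s^(k+1) y]. By [weak_commutation], [q] pushes [s^k y] back by
    less than one step of [s], and rounding [z] down to [s^k y] costs one more; hence the two
    factors [s]. *)
Lemma displacement_right q y z : le y (q * y) -> le y z ->
  lt z (s * (s * (q * z))).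
Proof.
move=> qy /cofinal_floor[[|k] [kz zk]].
  apply: (pre_lt_trans le_pre zk); rewrite expg1; apply: (pre_lt_mul le_pre).
  apply: (pre_le_lt_trans le_pre (leT qy _)); last exact: cofinal_gt.
  by apply: leM; rewrite mul1g in kz.
apply: (pre_lt_trans le_pre zk); rewrite !expgS -!mulgA.
do 2!apply: (pre_lt_mul le_pre).
have sq := weak_commutation (@cofinal_gt y) qy (k := k).
exact: (pre_lt_le_trans le_pre sq (leM q kz)).
Qed.

End Cofinal.

End Conradian.

(** * Elements with cofinal powers *)

Section Positive.
Variables (G : groupType) (le : G -> G -> Prop).
Hypotheses (le_pre : left_preorder le) (le_free : crossing_free le).
Hypothesis ge_free : crossing_free (fun a b => le b a).
Variable s : G.
Local Open Scope group_scope.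
Local Notation lt a b := (~ le b a).
Hypothesis s_gt1 : lt 1 s.
Hypothesis s_cofinal : forall g, exists n, le (s ^- n) g /\ le g (s ^+ n).
Implicit Types (a b c f g q r t v x y z : G).
Let leM := pre_mul le_pre.
Let leT := pre_trans le_pre.
Let ltW := pre_ltW le_pre.
Let leX := pre_expg le_pre.
Let lt_leT := pre_lt_le_trans le_pre.

(* [displacement_right] in the reversed order covers the points to the left of
   [y], so one point moved to the left bounds the displacement everywhere. *)
Lemma displacement q y z : le (q * y) y -> lt (q * z) (s * (s * z)).
Proof.
move=> qy; have [yz|zy] := pre_total le_pre y z.
  have := displacement_right le_pre le_free s_gt1 s_cofinal
    (q := q^-1) (y := q * y) (z := q * z).
  by rewrite !mulKg; apply => //; exact: leM.
have sV1 : ~ le 1 s^-1 by move=> /(leM s); rewrite mulg1 mulgV.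
have sVc g : exists n, le g (s^-1 ^- n) /\ le (s^-1 ^+ n) g.
  by have [n [ng gn]] := s_cofinal g; exists n; rewrite expVgn invgK.
have := displacement_right (left_preorder_rev le_pre) ge_free sV1 sVc qy zy.
by move=> h /(leM s^-1); rewrite mulKg => /(leM s^-1); rewrite mulKg.
Qed.

(** Quantifying over the base point [y] makes the property invariant under conjugation; by
    [cofinal_upP], one bounded orbit already controls all of them. *)
Definition cofinal_up v : Prop := forall y z, exists n, lt z (v ^+ n * y).

(** Some orbit [q^n y] is bounded. No power of [q] moves [y] as far as [s y], since by
    [dominated_powers] its iterates would then pass every [s^k y]. So [s^-1 q^n] moves [y] to the
    left, and [displacement] bounds it at every [z], uniformly in [n]. *)
Lemma cofinal_upP q : ~ cofinal_up q ->
  forall n z, lt (q ^+ n * z) (s * (s * (s * z))).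
Proof.
move=> qN n z.
have [y [b qb]] : exists y b, forall n, le (q ^+ n * y) b.
  apply: contra_notP qN => qN y b; apply: contrapT => qb; apply: qN.
  by exists y, b => m; apply: contrapT => qm; apply: qb; exists m.
have qs m : lt (q ^+ m * y) (s * y).
  move=> sq; have sy := cofinal_gt le_pre s_gt1 s_cofinal (y := y).
  have [k bk] : exists k, lt b (s ^+ k * y).
    have [yb|yb] := pselect (le y b); last by exists 0%N; rewrite mul1g.
    by have [k [_]] := cofinal_floor le_pre s_gt1 s_cofinal yb; exists k.+1.
  have [N] := dominated_powers le_pre le_free (ltW sy) sq k.
  by rewrite -expgnA => h; apply: bk; apply: leT h _; exact: qb.
have := displacement (q := s^-1 * q ^+ n) (y := y) (z := z).
rewrite -!mulgA => h h'; apply: h; first by apply/(pre_Vmul le_pre)/ltW/qs.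
by move: h' => /(leM s^-1); rewrite mulKg.
Qed.

(* If [q r] is cofinal, pick [y] near the left end of the [r]-orbit of [1] such
   that [q] moves both [y] and [r^-1 y] to the right of [y]; some [q ^+ n y] is
   moved by [r] beyond all the [q ^+ k y], and [q ^+ n.+1 r^-1] and [q ^+ n.+1]
   then form a crossing at [q ^+ n y]. *)
Lemma cofinal_upM q r : ~ cofinal_up q -> ~ cofinal_up r -> ~ cofinal_up (q * r).
Proof.
move=> /cofinal_upP qP /cofinal_upP rP vc.
pose D w := exists n, le (r ^- n) w.
have DV w : D w -> D (r^-1 * w).
  move=> [n rw]; exists n.+1; rewrite expgSr invgM; exact: leM.
have D_lb w : D w -> lt 1 (s * (s * (s * w))).
  move=> [n rw]; have := rP n (r ^- n); rewrite mulgV => h.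
  by apply: lt_leT h _; do 3!apply: leM.
(* Otherwise [D], already stable under [r^-1], is stable under [q^-1] and contains every [(q r)^-n];
   but [D] is bounded below by [s^-3], while the powers of [q r] are cofinal. *)
have [y [Dy yD]] : exists y, D y /\ forall w, D w -> lt y (q * w).
  apply: contrapT => nD.
  have DqV y : D y -> D (q^-1 * y).
    move=> Dy; apply: contrapT => nDq; apply: nD; exists y; split => // w [n rw] qw.
    by apply: nDq; exists n; apply: leT rw _; exact: (pre_mulV le_pre).
  have DX n : D ((q * r) ^- n).
    elim: n => [|n IHn]; first by exists 0%N; exact: (pre_refl le_pre).
    by rewrite expgSr !invgM -mulgA; apply/DV/DqV.
  have [n] := vc (s^-1 * (s^-1 * s^-1)) 1; apply.
  have /D_lb/ltW := DX n.
  do 3!move/(pre_Vmul le_pre); rewrite mulg1 => /(leM ((q * r) ^+ n)).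
  by rewrite mulgV.
have yq : le y (q * y) by apply/ltW/yD.
(* Otherwise every [(q r)^m y] lies below some [q^k y], hence below [s^3 y]. *)
have [n yn] : exists n, forall k, lt (q ^+ k * y) (r * (q ^+ n * y)).
  apply: contrapT => nk.
  have rk m : exists k, le (r * (q ^+ m * y)) (q ^+ k * y).
    apply: contrapT => mk; apply: nk; by exists m => k h; apply: mk; exists k.
  have Lv m : exists k, le ((q * r) ^+ m * y) (q ^+ k * y).
    elim: m => [|m [k vk]]; first by exists 0%N; exact: (pre_refl le_pre).
    have [j rj] := rk k; exists j.+1; rewrite !expgS -!mulgA; apply: leM.
    by apply: leT rj; exact: leM.
  have [m] := vc y (s * (s * (s * y))); apply.
  by have [k vk] := Lv m; apply: leT vk _; exact/ltW/qP.
pose x := q ^+ n * y; pose f := q ^+ n.+1 * r^-1.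
have gx : le x (q ^+ n.+1 * x).
  rewrite /x mulgA -expgnDr; apply: (pre_expg_le le_pre) => //.
  exact: leq_addl.
have fx : le x (f * x).
  rewrite /f expgSr -!mulgA; apply: leM; apply: (leT (ltW (yD _ (DV _ Dy)))).
  by do 2!apply: leM; exact: leX.
have := le_free fx gx; rewrite /f -mulgA => /(pre_mulI le_pre) /(leM r).
by rewrite mulVKg /x !mulgA -!expgnDr -mulgA; exact: yn.
Qed.

Lemma cofinal_up_gt v y : cofinal_up v -> lt y (v * y).
Proof.
move=> vc vy; have [n] := vc y y; apply.
exact: (pre_expg (left_preorder_rev le_pre)).
Qed.

Lemma cofinal_upJ v g : cofinal_up v -> cofinal_up (v ^ g).
Proof.
move=> vc y z; have [n] := vc (g * y) (g * z); exists n.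
by rewrite -conjXg /conjg -!mulgA => /(leM g); rewrite mulVKg.
Qed.

End Positive.

(** * Integer powers and Hoelder's theorem *)

Definition zexpg (G : groupType) (s : G) (i : int) : G :=
  match i with Posz n => s ^+ n | Negz n => s ^- n.+1 end%g.

Lemma zexpgD (G : groupType) (s : G) i j :
  zexpg s (i + j) = (zexpg s i * zexpg s j)%g.
Proof.
have S k : zexpg s (k + 1) = (zexpg s k * s)%g.
  case: k => [n|[|n]]; first by rewrite -PoszD addn1 /= expgSr.
    by rewrite /= expg1 mulVg.
  rewrite (_ : Negz n.+1 + 1 = Negz n) /=; last by rewrite !NegzE; lia.
  by rewrite [in RHS]expgS invgM mulgVK.
have P k : zexpg s (k - 1) = (zexpg s k * s^-1)%g.
  by rewrite -[in RHS](subrK 1 k) S mulgK.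
elim/int_ind: j => [|n IHn|n IHn]; first by rewrite addr0 mulg1.
  by rewrite -addn1 PoszD addrA S IHn -mulgA -S.
by rewrite -addn1 PoszD opprD addrA P IHn -mulgA -P.
Qed.

Lemma zexpgX (G : groupType) (s : G) (n : nat) : zexpg s n = (s ^+ n)%g.
Proof. by []. Qed.

Lemma zexpgN (G : groupType) (s : G) (n : nat) : zexpg s (- n%:Z) = (s ^- n)%g.
Proof. by case: n => [|n]; rewrite ?oppr0 /= ?invg1 // -NegzE. Qed.

Section MorphismToRing.
Variables (G : groupType) (S : pzRingType) (phi : G -> S).
Hypothesis phiM : {morph phi : g h / (g * h)%g >-> g + h}.

Lemma additive_morph1 : phi 1%g = 0.
Proof. by apply: (addIr (phi 1%g)); rewrite -phiM mulg1 add0r. Qed.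

Lemma additive_morphV g : phi g^-1%g = - phi g.
Proof.
by apply/eqP; rewrite -subr_eq0 opprK -phiM mulVg additive_morph1.
Qed.

Lemma additive_morph_zexpg g k : phi (zexpg g k) = k%:~R * phi g.
Proof.
elim/int_ind: k => [|n IHn|n IHn]; first by rewrite mul0r additive_morph1.
  by rewrite -addn1 PoszD zexpgD phiM IHn rmorphD mulrDl mul1r.
rewrite -addn1 PoszD opprD zexpgD phiM IHn rmorphD mulrDl /= additive_morphV.
by rewrite rmorphN1 mulN1r.
Qed.

End MorphismToRing.

Section Hoelder.
Variables (R : realType) (G : groupType) (le : G -> G -> Prop) (s : G).
Local Notation lt a b := (~ le b a).
Hypothesis le_pre : left_preorder le.
Hypothesis le_mulr : forall a b c, le a b -> le (a * c)%g (b * c)%g.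
Hypothesis s_gt1 : lt 1%g s.
Hypothesis s_unit : forall g, exists n, le (s ^- n)%g g /\ le g (s ^+ n)%g.

Implicit Types (g h : G) (i j k : int) (m n : nat).
Let leM := pre_mul le_pre.
Let leT := pre_trans le_pre.

Lemma hoelder_zexpg i j : i <= j -> le (zexpg s i) (zexpg s j).
Proof.
move=> ij; have -> : j = i + `|j - i|%N by lia.
rewrite zexpgD -[X in le X _]mulg1; apply: leM => /=.
rewrite -[(s ^+ _)%g]mulg1; apply: (pre_expg le_pre).
by rewrite mulg1; exact: (pre_ltW le_pre).
Qed.

Lemma hoelder_floor g :
  exists i, le (zexpg s i) g /\ lt g (zexpg s (i + 1)).
Proof.
have [n [sg _]] := s_unit g; have [m [_ gs]] := s_unit g.
(* Shifting exponents by [n] turns the search for the floor into an induction on a natural number,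
   starting at the lower bound [s^-n]. *)
have [N] : exists N, lt g (zexpg s (N%:Z - n%:Z)).
  exists (n + m.+1)%N; apply: (pre_le_lt_trans le_pre gs).
  rewrite PoszD addrC addKr zexpgX expgSr -{2}[(s ^+ m)%g]mulg1.
  exact: (pre_lt_mul le_pre).
elim: N => [|N IHN] gN; first by rewrite sub0r zexpgN in gN.
have [/IHN//|/contrapT sNg] := pselect (lt g (zexpg s (N%:Z - n%:Z))).
by exists (N%:Z - n%:Z); split => //; rewrite addrAC -PoszD addn1.
Qed.

Definition hoelder_fl g : int := projT1 (cid (hoelder_floor g)).
Local Notation T := hoelder_fl.

Lemma le_hoelder_fl i g : le (zexpg s i) g <-> i <= T g.
Proof.
rewrite /T; case: cid => j /= [jg gj]; split=> [ig|ij].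
  rewrite leNgt; apply/negP => ji; apply: gj; apply: leT ig.
  by apply: hoelder_zexpg; lia.
by apply: leT jg; exact: hoelder_zexpg.
Qed.

Lemma hoelder_fl_le g h : le g h -> T g <= T h.
Proof. by move=> gh; apply/le_hoelder_fl/(leT _ gh)/le_hoelder_fl. Qed.

Lemma hoelder_flM_ge g h : T g + T h <= T (g * h)%g.
Proof.
apply/le_hoelder_fl; rewrite zexpgD.
apply: (@leT (zexpg s (T g) * h)%g); first exact/leM/le_hoelder_fl.
exact/le_mulr/le_hoelder_fl.
Qed.

Lemma hoelder_flM_le g h : T (g * h)%g <= T g + T h + 1.
Proof.
rewrite leNgt; apply/negP => gh.
have lt_fl f : lt f (zexpg s (T f + 1)) by move/le_hoelder_fl; lia.
have /le_hoelder_fl : T g + 1 + (T h + 1) <= T (g * h)%g by lia.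
rewrite zexpgD; apply: (pre_le_lt_trans le_pre (b := (zexpg s (T g + 1)%R * h)%g)).
  by apply: le_mulr; apply: (pre_ltW le_pre); exact: lt_fl.
by apply: (pre_lt_mul le_pre); exact: lt_fl.
Qed.

(** Rotating, [(g h)^(n+1) = g (h g)^n h]; comparing [(g h)^n] with [(h g)^n] in the middle lets
    both outer bounds follow by induction. *)
Lemma hoelder_expgM g h n : le (g * h)%g (h * g)%g ->
  [/\ le (g ^+ n * h ^+ n)%g ((g * h) ^+ n)%g,
      le ((g * h) ^+ n)%g ((h * g) ^+ n)%g
    & le ((h * g) ^+ n)%g (h ^+ n * g ^+ n)%g].
Proof.
move=> ghhg.
have le_mul a b c d : le a b -> le c d -> le (a * c)%g (b * d)%g.
  by move=> ab cd; apply: leT (leM b cd); exact: le_mulr.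
have rot (a b : G) (k : nat) : ((a * b) ^+ k.+1 = a * (b * a) ^+ k * b)%g.
  elim: k => [|k IHk]; first by rewrite expg0 mulg1.
  by rewrite expgS IHk (expgS (b * a)%g) !mulgA.
have le_exp (k : nat) : le ((g * h) ^+ k)%g ((h * g) ^+ k)%g.
  elim: k => [|k IHk]; first exact: (pre_refl le_pre).
  by rewrite !expgS; exact: le_mul.
split=> //; elim: n => [|n IHn]; rewrite ?expg0 ?mulg1; try exact: (pre_refl le_pre).
  rewrite rot expgS (expgSr h) !mulgA; apply: le_mulr.
  by rewrite -mulgA; apply: leM; apply: leT (le_exp n).
rewrite rot (expgS h) (expgSr g) !mulgA; apply: le_mulr.
by rewrite -mulgA; apply: leM; apply: leT IHn.
Qed.

(** The error 1 is uniform in [n], which makes the slope additive although [G] need not be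
    commutative. *)
Lemma hoelder_fl_expgM g h n :
  T (g ^+ n)%g + T (h ^+ n)%g <= T ((g * h) ^+ n)%g
    <= T (g ^+ n)%g + T (h ^+ n)%g + 1.
Proof.
have [gh|hg] := pre_total le_pre (g * h)%g (h * g)%g.
  have [h1 h2 h3] := hoelder_expgM n gh; apply/andP; split.
    by apply: le_trans (hoelder_flM_ge _ _) _; exact: hoelder_fl_le.
  rewrite [T (g ^+ n)%g + _]addrC; apply: le_trans (hoelder_flM_le _ _).
  exact/hoelder_fl_le/(leT h2).
have [h1 h2 h3] := hoelder_expgM n hg; apply/andP; split.
  rewrite addrC; apply: le_trans (hoelder_flM_ge _ _) _.
  exact/hoelder_fl_le/(leT h1).
by apply: le_trans (hoelder_flM_le _ _); exact: hoelder_fl_le.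
Qed.

(** The translation number of [g] relative to [s]. Exponents start at 1 to keep the denominator
    nonzero. *)
Definition hoelder_slope g : R :=
  sup [set (T (g ^+ n.+1)%g)%:~R / n.+1%:R | n in [set: nat]].

Lemma hoelder_fl_mul g m n :
  n%:Z * T (g ^+ m)%g <= T (g ^+ (m * n))%g <= n%:Z * (T (g ^+ m)%g + 1).
Proof.
have T1 : T 1%g = 0.
  have := (le_hoelder_fl 0 1%g).1 (pre_refl le_pre _).
  by have := hoelder_flM_ge 1%g 1%g; rewrite mulg1; lia.
elim: n => [|n /andP[IH1 IH2]]; first by rewrite muln0 expg0 T1 !mul0r.
rewrite mulnS expgnDr -(addn1 n) PoszD.
have := hoelder_flM_ge (g ^+ m)%g (g ^+ (m * n))%g.
have := hoelder_flM_le (g ^+ m)%g (g ^+ (m * n))%g.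
move: IH1 IH2; move: (T _) (T (_ ^+ (_ * _))%g) (T _) => a b c.
by rewrite !mulrDl !mulrDr; lia.
Qed.

Lemma hoelder_slopeP g n : (0 < n)%N ->
  (T (g ^+ n)%g)%:~R <= n%:R * hoelder_slope g <= (T (g ^+ n)%g)%:~R + 1.
Proof.
case: n => // n _.
pose E : set R := [set (T (g ^+ n.+1)%g)%:~R / n.+1%:R | n in [set: nat]].
(* Estimating the floor of [g^((m+1)(k+1))] through [g^(k+1)] from below and through [g^(m+1)] from
   above compares the two quotients. *)
have ub m : ubound E (((T (g ^+ m.+1)%g)%:~R + 1) / m.+1%:R).
  move=> _ [k _ <-]; rewrite ler_pdivrMr ?ltr0Sn// mulrAC ler_pdivlMr ?ltr0Sn//.
  have /andP[_ ge1] := hoelder_fl_mul g m.+1 k.+1.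
  have /andP[le1 _] := hoelder_fl_mul g k.+1 m.+1.
  rewrite mulnC in ge1; have := le_trans le1 ge1.
  rewrite -(ler_int R) !rmorphM rmorphD /= -!pmulrn.
  by rewrite mulrC [X in _ <= X]mulrC.
apply/andP; split; rewrite mulrC.
  rewrite -ler_pdivrMr ?ltr0Sn//.
  apply: ub_le_sup; last by exists n.
  by exists (((T (g ^+ 1)%g)%:~R + 1) / 1%:R); exact: (ub 0%N).
rewrite -ler_pdivlMr ?ltr0Sn//.
by apply: ge_sup => //; exists ((T (g ^+ 1)%g)%:~R / 1%:R), 0%N.
Qed.

(** The additivity defect, multiplied by any positive [n], stays at most 2 in absolute value, so it
    vanishes. *)
Lemma hoelder_slopeM g h :
  hoelder_slope (g * h)%g = hoelder_slope g + hoelder_slope h.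
Proof.
set d := hoelder_slope (g * h)%g; set a := hoelder_slope g; set b := hoelder_slope h.
have bnd n : (0 < n)%N -> `|n%:R * (d - (a + b))| <= 2.
  move=> n0; have /andP[g1 g2] := hoelder_slopeP g n0.
  have /andP[h1 h2] := hoelder_slopeP h n0.
  have /andP[d1 d2] := hoelder_slopeP (g * h)%g n0.
  have /andP[] := hoelder_fl_expgM g h n.
  rewrite -!(ler_int R) !rmorphD /= => e1 e2.
  rewrite -/d -/a -/b in g1 g2 h1 h2 d1 d2.
  by rewrite mulrBr mulrDr ler_norml; apply/andP; split; lra.
apply/eqP; rewrite -subr_eq0; apply/negPn/negP => e0.
have e_gt0 : 0 < `|d - (a + b)| by rewrite normr_gt0.
pose n := Num.truncn (2 / `|d - (a + b)|).
have := bnd n.+1 isT; rewrite normrM normr_nat leNgt => /negP; apply.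
by rewrite -ltr_pdivrMr//; exact: truncnS_gt.
Qed.

Lemma hoelder_slope_gt0 : 0 < hoelder_slope s.
Proof.
have /andP[+ _] := hoelder_slopeP s (isT : (0 < 1)%N).
rewrite mul1r expg1; apply: lt_le_trans; rewrite ltr0z.
have /le_hoelder_fl : le (zexpg s 1) s by exact: (pre_refl le_pre).
by lia.
Qed.

End Hoelder.

(** * Finitely generated subgroups of the reals and integer-valued morphisms *)

Fixpoint int_span (R : realType) (l : seq R) : set R :=
  if l is r :: l' then [set x | exists n : int, int_span l' (x - n%:~R * r)]
  else [set 0].

Lemma int_span0 (R : realType) (l : seq R) : int_span l 0.
Proof. by elim: l => //= r l IHl; exists 0; rewrite mul0r subr0. Qed.

Lemma int_spanB (R : realType) (l : seq R) (x y : R) :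
  int_span l x -> int_span l y -> int_span l (x - y).
Proof.
elim: l x y => [x y /= -> ->|r l IHl x y /= [n xn] [m ym]]; first by rewrite subrr.
by exists (n - m); have := IHl _ _ xn ym; congr int_span; rewrite rmorphB /=; ring.
Qed.

Lemma int_spanD (R : realType) (l : seq R) (x y : R) :
  int_span l x -> int_span l y -> int_span l (x + y).
Proof.
move=> lx ly; rewrite -[y]opprK; apply: int_spanB => //.
by rewrite -sub0r; apply: int_spanB => //; exact: int_span0.
Qed.

Lemma int_spanZ (R : realType) (l : seq R) (n : int) (x : R) :
  int_span l x -> int_span l (n%:~R * x).
Proof.
elim: l x => [x /= ->|r l IHl x /= [m xm]]; first by rewrite mulr0.
by exists (n * m); have := IHl _ xm; congr int_span; rewrite rmorphM /=; ring.
Qed.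

Lemma mem_int_span (R : realType) (l : seq R) (x : R) :
  x \in l -> int_span l x.
Proof.
elim: l => //= r l IHl; rewrite inE => /orP[/eqP->|/IHl xl].
  by exists 1; rewrite mul1r subrr; exact: int_span0.
by exists 0; rewrite mul0r subr0.
Qed.

(* Adjoining a generator [r] to the span [V] of the others: if [N r] lies in [V]
   with [N != 0], then [x |-> psi (N x)] extends [N psi]; otherwise the sum
   [V + Z r] is direct. *)
Lemma int_span_functional (R : realType) (l : seq R) :
  (exists2 x, int_span l x & x != 0) ->
  exists psi : R -> int,
    (forall x y, int_span l x -> int_span l y -> psi (x + y) = psi x + psi y) /\
    (exists2 x, int_span l x & psi x != 0).
Proof.
elim: l => [[x /= -> /eqP//]|r l IHl [x0 /= [n0 x0l] x0_neq0]].
(* When the span of [l] is zero, the whole span is [Z r] with [r != 0], and [psi] reads off the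
   coefficient. *)
have [l0|] := pselect (exists2 x, int_span l x & x != 0); last first.
  move=> l0; have {}l0 x : int_span l x -> x = 0.
    by move=> lx; apply/eqP/negPn/negP => x_neq0; apply: l0; exists x.
  have r_neq0 : r != 0.
    by apply: contraNneq x0_neq0 => r0; move/l0: x0l; rewrite r0 mulr0 subr0 => ->.
  have ex x : exists n : int, int_span (r :: l) x -> x = n%:~R * r.
    have [[n xn]|nx] := pselect (int_span (r :: l) x); last by exists 0.
    by exists n => _; apply/eqP; rewrite -subr_eq0 (l0 _ xn).
  pose psi x := projT1 (cid (ex x)).
  have psiE x : int_span (r :: l) x -> x = (psi x)%:~R * r.
    by rewrite /psi; case: cid.
  exists psi; split=> [x y lx ly|].
    have := psiE _ (@int_spanD R (r :: l) x y lx ly).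
    rewrite {1}(psiE _ lx) {1}(psiE _ ly).
    by rewrite -mulrDl => /(mulIf r_neq0); rewrite -rmorphD /= => /intr_inj.
  exists x0; first by exists n0.
  apply: contraNneq x0_neq0 => psi0; rewrite [x0]psiE; last by exists n0.
  by rewrite psi0 mul0r.
have [psi [psiD [x1 lx1 psix1]]] := IHl l0.
have [[N N_neq0 lNr]|noN] := pselect (exists2 N : int, N != 0 & int_span l (N%:~R * r)).
  have NV x : int_span (r :: l) x -> int_span l (N%:~R * x).
    move=> [n xn]; have := int_spanD (int_spanZ N xn) (int_spanZ n lNr).
    by congr int_span; ring.
  exists (fun x => psi (N%:~R * x)); split=> [x y /NV lx /NV ly|].
    by rewrite mulrDr psiD.
  exists x1; first by exists 0; rewrite mul0r subr0.
  (* [psi] is additive only on the span, so its homogeneity is proved there; it shows that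
     [psi (N x1)] is nonzero. *)
  have psiX (n : nat) x : int_span l x -> psi (n%:R * x) = n%:Z * psi x.
    move=> lx; elim: n => [|n IHn].
      rewrite !mul0r; apply: (addIr (psi 0)).
      by rewrite -psiD ?add0r//; exact: int_span0.
    rewrite -natr1 mulrDl mul1r psiD//; last exact: (int_spanZ n).
    by rewrite IHn -addn1 PoszD mulrDl mul1r.
  have psiN x : int_span l x -> psi (- x) = - psi x.
    move=> lx; apply/eqP; rewrite -subr_eq0 opprK -psiD//.
      rewrite addNr -[0 as X in psi X](mul0r (0 : R)) -[0 as X in psi (X * _)]/(0%:R).
      by rewrite (psiX 0%N) ?mul0r//; exact: int_span0.
    by rewrite -sub0r; apply: int_spanB => //; exact: int_span0.
  case: N N_neq0 {lNr NV} => [n|n] n_neq0.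
    by rewrite psiX// mulf_neq0.
  rewrite NegzE rmorphN mulNr psiN; last exact: (int_spanZ n.+1).
  by rewrite psiX// oppr_eq0 mulf_neq0.
(* The coefficient of [r] is made a total function, with junk value 0 outside the span; on the span
   it is unique because no nonzero multiple of [r] lies in the span of [l]. *)
have ex x : exists n : int, int_span (r :: l) x -> int_span l (x - n%:~R * r).
  have [[n xn]|nx] := pselect (int_span (r :: l) x); last by exists 0.
  by exists n.
pose c x := projT1 (cid (ex x)).
have cP x : int_span (r :: l) x -> int_span l (x - (c x)%:~R * r).
  by rewrite /c; case: cid.
have c_uniq x n : int_span l (x - n%:~R * r) -> c x = n.
  move=> xn; have xc := cP x (ex_intro _ n xn).
  apply/eqP; rewrite -subr_eq0; apply/negPn/negP => cn; apply: noN.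
  exists (c x - n) => //; have := int_spanB xn xc.
  by congr int_span; rewrite rmorphB /=; ring.
exists (fun x => psi (x - (c x)%:~R * r)); split=> [x y lx ly|].
  have -> : c (x + y) = c x + c y.
    apply: c_uniq; have := int_spanD (cP _ lx) (cP _ ly).
    by congr int_span; rewrite rmorphD /=; ring.
  by rewrite -psiD; [congr psi; rewrite rmorphD /=; ring|exact: cP|exact: cP].
have cx1 : c x1 = 0 by apply: c_uniq; rewrite mul0r subr0.
exists x1; first by exists 0; rewrite mul0r subr0.
by rewrite cx1 mul0r subr0.
Qed.

(** The least positive value [d] of [phi] divides all its values, since a remainder modulo [d] is
    again a value; dividing by [d] gives a surjection. *)
Lemma surjective_int_morphism (G : groupType) (phi : G -> int) :
  {morph phi : g h / (g * h)%g >-> g + h} -> (exists g, phi g != 0) ->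
  exists phi' : G -> int,
    {morph phi' : g h / (g * h)%g >-> g + h} /\
    set_surj [set: G] [set: int] phi'.
Proof.
move=> phiM [g0 g0_neq0]; have phiX g k : phi (zexpg g k) = k * phi g.
  by rewrite additive_morph_zexpg// intz.
have [d [gd [d_gt0 dE]] dmin] : exists2 d : nat, (exists g, (0 < d)%N /\ phi g = d%:Z) &
    forall n, (exists g, (0 < n)%N /\ phi g = n%:Z) -> (d <= n)%N.
  pose P n := `[< exists g, (0 < n)%N /\ phi g = n%:Z >].
  have exP : exists n, P n.
    exists `|phi g0|%N; apply/asboolP.
    exists (zexpg g0 (Num.sg (phi g0))); rewrite absz_gt0 phiX; split => //.
    by rewrite abszE normrEsg.
  have [d /asboolP Pd dmin] := ex_minnP exP.
  by exists d => // n Pn; apply: dmin; apply/asboolP.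
have dvd g : (d %| phi g)%Z.
  apply/dvdz_mod0P; apply: contrapT => /eqP r_neq0.
  have r_ge0 : 0 <= (phi g %% d)%Z by (rewrite modz_ge0; lia).
  have r_ltd : (phi g %% d)%Z < d%:Z by (apply: ltz_pmod; lia).
  suff : (d <= `|(phi g %% d)%Z|)%N by (move=> ?; lia).
  apply: dmin.
  exists (g * zexpg gd (- (phi g %/ d)%Z))%g; split; first by rewrite absz_gt0.
  by rewrite gez0_abs// phiM phiX dE {1}(divz_eq (phi g) d) mulNr addrAC subrr add0r.
exists (fun g => (phi g %/ d)%Z); split=> [g h|k _].
  by rewrite phiM divzDl.
exists (zexpg gd k) => //; rewrite phiX dE mulzK//; lia.
Qed.

Lemma fg_real_morphism_int (R : realType) (G : groupType) (tau : G -> R) :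
  finitely_generated G -> {morph tau : g h / (g * h)%g >-> g + h} ->
  (exists g, tau g != 0) ->
  exists phi : G -> int,
    {morph phi : g h / (g * h)%g >-> g + h} /\
    set_surj [set: G] [set: int] phi.
Proof.
move=> [A /finite_seqP[l Al] genA] tauM [g0 g0_neq0].
pose V := int_span (map tau l).
have tauS g : V (tau g).
  have : smallest (@subgroup G) A g by rewrite genA.
  move=> /(_ [set g | V (tau g)]); apply; split; last first.
    by move=> a; rewrite Al /= => al; apply: mem_int_span; exact: map_f.
  split=> [|a b]; rewrite !inE /=; first by rewrite additive_morph1//; exact: int_span0.
  by rewrite tauM additive_morphV//; exact: int_spanB.
have [|psi [psiD [x Vx psix]]] := @int_span_functional R (map tau l).
  by exists (tau g0); [exact: tauS|].
(* The span is no larger than the image of [tau], so the point where [psi] is nonzero comes from an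
   element of [G]. *)
have im_tau (l' : seq G) y : int_span (map tau l') y -> exists g, tau g = y.
  elim: l' y => [y /= ->|a l' IHl y /= [n /IHl[g gE]]].
    by exists 1%g; exact: additive_morph1.
  exists (g * zexpg a n)%g.
  by rewrite tauM gE additive_morph_zexpg// subrK.
apply: (@surjective_int_morphism _ (psi \o tau)).
  by move=> g h /=; rewrite tauM psiD//; exact: tauS.
by have [g gx] := im_tau _ _ Vx; exists g; rewrite /= gx.
Qed.

(** * From a Conradian preorder to a morphism onto the integers *)

Lemma pre_max (G : groupType) (le : G -> G -> Prop) (x0 : G) (l : seq G) :
  left_preorder le -> exists2 x, x \in x0 :: l & forall a, a \in x0 :: l -> le a x.
Proof.
move=> le_pre; elim: l => [|b l [x xl xmax]].
  by exists x0; rewrite ?mem_head// => a /[!inE] /eqP ->; exact: pre_refl.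
have [bx|xb] := pre_total le_pre b x.
  exists x; first by move: xl; rewrite !inE orbCA => ->; rewrite orbT.
  move=> a; rewrite !inE orbCA => /orP[/eqP->//|al].
  by apply: xmax; rewrite inE.
exists b; first by rewrite !inE eqxx orbT.
move=> a; rewrite !inE orbCA => /orP[/eqP->|al]; first exact: pre_refl.
by apply: (pre_trans le_pre (xmax _ _) xb); rewrite inE.
Qed.

(** Take [s] largest among the generators and their inverses, and [t = s^4]; apply
    [generator_powers_bounded] to [t], and to [t^-1] in the reversed order. *)
Lemma conradian_unit (G : groupType) (le : G -> G -> Prop) (l : seq G) :
  left_preorder le -> crossing_free le -> crossing_free (fun a b => le b a) ->
  smallest (@subgroup G) [set` l] = [set: G] ->
  (exists2 a, a \in l & ~ (le a 1%g /\ le 1%g a)) ->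
  exists2 t, ~ le t 1%g & forall g, exists n, le (t ^- n)%g g /\ le g (t ^+ n)%g.
Proof.
move=> le_pre le_free ge_free genl [a0 a0l a0N].
have leM := pre_mul le_pre; have leT := pre_trans le_pre.
have [s _ smax] := pre_max a0 (l ++ [seq a^-1%g | a <- l]) le_pre.
have {}smax a : a \in l -> le a s /\ le a^-1%g s.
  by move=> al; split; apply: smax;
    rewrite inE mem_cat ?(map_f (fun a => a^-1%g) al) ?al ?orbT.
have s_gt1 : ~ le s 1%g.
  move=> s1; apply: a0N; have [as_ aVs] := smax _ a0l; split; first exact: leT s1.
  by have /(leM a0) := leT _ _ _ aVs s1; rewrite mulgV mulg1.
have sX m n : (m <= n)%N -> le (s ^+ m)%g (s ^+ n)%g.
  move=> mn; have := pre_expg_le le_pre (s := s) (y := 1%g) _ mn; rewrite !mulg1.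
  by apply; exact: (pre_ltW le_pre).
(* A left preorder does not turn [a^-1 <= s] into [s^-1 <= a]. Reversed crossing-freeness for
   [s^-2 a^-1] and [s^-2] yields the weaker [s^-4 <= a], whence the exponent 4. *)
have lb a : le a^-1%g s -> le (s ^+ 4)^-1%g a.
  move=> aVs.
  have f1 : le (s ^- 2 * a^-1 * 1)%g 1%g.
    rewrite mulg1; apply/(pre_Vmul le_pre)/(leT _ _ _ aVs).
    by rewrite mulg1 -{1}[s]expg1; exact: sX.
  have g1 : le (s ^- 2 * 1)%g 1%g.
    by apply: (pre_Vmul le_pre); rewrite mulg1 -[1%g](expg0 s); exact: sX.
  have := ge_free _ _ _ f1 g1; rewrite !mulg1 -{4}[(s ^- 2)%g]mulg1 -mulgA.
  move=> /(pre_mulI le_pre) /(leM a); rewrite mulVKg mulg1 -invgM -expgnDr.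
  exact.
pose t := (s ^+ 4)%g.
have t_gt1 : ~ le t 1%g by move=> t1; apply: s_gt1; apply: leT t1; exact: (sX 1%N).
have tV1 : le t^-1%g 1%g.
  by rewrite -[t^-1%g]mulg1; apply: (pre_Vmul le_pre); rewrite mulg1; exact: (sX 0%N).
have ub a : le a s -> le a t by move=> h; apply: leT h _; exact: (sX 1%N).
exists t => // g; have Tg : smallest (@subgroup G) [set` l] g by rewrite genl.
have [||n gn] := generator_powers_bounded le_pre le_free _ _ Tg (t := t).
- exact: (pre_ltW le_pre).
- by move=> a /smax[? ?]; split; exact: ub.
have [||m mg] :=
    generator_powers_bounded (left_preorder_rev le_pre) ge_free _ _ Tg (t := t^-1%g).
- exact: tV1.
- by move=> a /smax[h h']; split; apply: lb; rewrite ?invgK.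
have tX : le 1%g (t * 1)%g by rewrite mulg1; exact: (pre_ltW le_pre).
exists (n + m)%N; split.
  apply: leT mg; rewrite -expVgn.
  have := pre_expg_le (left_preorder_rev le_pre) (s := t^-1%g) (y := 1%g) _
    (leq_addl n m).
  by rewrite !mulg1 => /(_ tV1).
apply: leT gn _; have := pre_expg_le le_pre tX (leq_addr m n).
by rewrite !mulg1.
Qed.

(** For [LE], totality holds because an element and its inverse cannot both move all points to the
    right, transitivity is [cofinal_upM], and right invariance is [cofinal_upJ]. With the order unit
    [t], the slope is a morphism that is positive at [t]. *)
Lemma conradian_int_morphism (R : realType) (G : groupType)
    (le : G -> G -> Prop) (l : seq G) :
  left_preorder le -> crossing_free le -> crossing_free (fun a b => le b a) ->
  smallest (@subgroup G) [set` l] = [set: G] ->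
  (exists2 a, a \in l & ~ (le a 1%g /\ le 1%g a)) ->
  exists phi : G -> int,
    {morph phi : g h / (g * h)%g >-> g + h} /\
    set_surj [set: G] [set: int] phi.
Proof.
move=> le_pre le_free ge_free genl ntl.
have [t t_gt1 t_cof] := conradian_unit le_pre le_free ge_free genl ntl.
pose LE g h := ~ cofinal_up le (h^-1 * g)%g.
have LE_of_le g h : le g h -> LE g h.
  move=> gh /(cofinal_up_gt le_pre) => /(_ 1%g); apply; rewrite mulg1.
  by apply: (pre_Vmul le_pre); rewrite mulg1.
have LE_pre : left_preorder LE.
  split=> [a b|b a c ab bc|c a b ab].
  - have [abN|] := pselect (cofinal_up le (b^-1 * a)%g); last by left.
    right=> baN; have := cofinal_up_gt le_pre baN (y := (b^-1 * a)%g).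
    rewrite -mulgA mulVKg mulVg => h; apply: h.
    by have := cofinal_up_gt le_pre abN (y := 1%g); rewrite mulg1; exact: pre_ltW.
  - rewrite /LE -(mulVKg b a) mulgA.
    exact: (cofinal_upM le_pre le_free ge_free t_gt1 t_cof).
  - by rewrite /LE invgM -mulgA mulKg.
have LE_mulr a b c : LE a b -> LE (a * c)%g (b * c)%g.
  move=> ab; apply: contra_not ab => /(cofinal_upJ le_pre) - /(_ c^-1%g).
  by rewrite invgM -mulgA (mulgA b^-1%g) -conjgE conjgK.
have t1 : ~ LE t 1%g.
  apply; rewrite invg1 mul1g => y z.
  have [yz|zy] := pselect (le y z); last by exists 0%N; rewrite mul1g.
  by have [k [_ zk]] := cofinal_floor le_pre t_gt1 t_cof yz; exists k.+1.
have t_unit g : exists n, LE (t ^- n)%g g /\ LE g (t ^+ n)%g.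
  by have [n [h1 h2]] := t_cof g; exists n; split; exact: LE_of_le.
apply: (fg_real_morphism_int (R := R) _ (hoelder_slopeM R LE_pre LE_mulr t1 t_unit)).
  by exists [set` l] => //; exact: finite_seq.
by exists t; rewrite gt_eqF//; exact: hoelder_slope_gt0.
Qed.

(** * Crossings are null, and limit orders along ultrafilters *)

Section NullCrossings.
Variables (R : realType) (G : groupType) (T : Type) (act : G -> T -> T).
Variable (m : set T -> R).
Hypotheses (actG : group_action act) (mean : invariant_mean act m).

Lemma mean_le1 A : m A <= 1.
Proof.
have [m1 m0 mU _] := mean.
by rewrite -m1 -(setUv A) mU ?setICr// lerDl.
Qed.

Lemma mean_setC A : m A = 0 -> m (~` A) = 1.
Proof.
by have [m1 _ mU _] := mean => A0; rewrite -m1 -(setUv A) mU ?setICr// A0 add0r.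
Qed.

Lemma mean_le A B : A `<=` B -> m A <= m B.
Proof.
have [_ m0 mU _] := mean => /setDUK <-.
by rewrite mU ?lerDl// setDIK.
Qed.

Lemma mean_setI A B : m A = 1 -> m B = 1 -> m (A `&` B) = 1.
Proof.
have [m1 m0 mU _] := mean => A1 B1.
have BC0 : m (~` B) = 0.
  by apply: (addrI (m B)); rewrite -mU ?setICr// setUv m1 B1 addr0.
have AB0 : m (A `\` B) = 0.
  by apply/eqP; rewrite eq_le m0 -BC0 andbT; apply: mean_le => x [].
rewrite -A1 -[in RHS](setUIDK A B) mU ?AB0 ?addr0//.
by apply/seteqP; split => // x [[_ Bx] [_ /(_ Bx)]].
Qed.

(* Finite additivity suffices: the preimages of [A] under the powers of [h] are
   disjoint and of equal mass. *)
Lemma mean_wandering (h : G) A :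
  (forall n x, (0 < n)%N -> A x -> ~ A (act (h ^+ n)%g x)) -> m A = 0.
Proof.
have [m1 m0 mU mG] := mean => hA.
pose B N := [set x | exists2 i, (i < N)%N & A (act (h ^+ i)%g x)].
have mB N : m (B N) = N%:R * m A.
  elim: N => [|N IHN].
    have -> : B 0%N = set0 by apply/seteqP; split => // x [].
    by rewrite mul0r; apply: (addIr (m set0)); rewrite -mU ?setI0// setU0 add0r.
  have -> : B N.+1 = A `|` (act h @^-1` B N).
    apply/seteqP; split=> [x [[_|i iN Ai]]|x [Ax|[i iN Ai]]].
    - by rewrite expg0 actG.1; left.
    - by right; exists i => //=; rewrite -actG.2 -expgSr.
    - by exists 0%N => //; rewrite expg0 actG.1.
    - by exists i.+1 => //; rewrite expgSr actG.2.
  rewrite mU ?mG ?IHN -?natr1 ?mulrDl ?mul1r 1?addrC//.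
  apply/seteqP; split=> // x [Ax [i _]] /=; rewrite -actG.2 -expgSr.
  exact: hA.
apply/eqP; rewrite eq_le m0 andbT leNgt; apply/negP => A_gt0.
pose N := (Num.truncn (m A)^-1).+1.
have := mean_le1 (B N); rewrite mB leNgt => /negP; apply.
by rewrite -ltr_pdivrMr// div1r; exact: truncnS_gt.
Qed.

Variable r : T -> T -> Prop.
Hypothesis r_total : forall x y, r x y \/ r y x.
Hypothesis r_trans : forall y x z, r x y -> r y z -> r x z.
Hypothesis r_act : forall g x y, r x y -> r (act g x) (act g y).

(* With [h = f g], no point of the set returns to it under a positive power of
   [h]. *)
Lemma mean_crossing f g :
  m [set x | [/\ r x (act f x), r x (act g x)
             & ~ r (act g x) (act f (act g (act g x)))]] = 0.
Proof.
apply: (mean_wandering (h := (f * g)%g)) => -[//|n] x _ [xf xg nfg] [zf _ _].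
have r_lt c y z : ~ r y z -> ~ r (act c y) (act c z).
  by move=> yz /(r_act c^-1%g); rewrite -!actG.2 !mulVg !actG.1.
pose h := (f * g)%g; have hE y : act h y = act f (act g y) by rewrite actG.2.
have xh : r x (act h x) by rewrite hE; apply: r_trans xf _; exact: r_act.
have hX y k : r y (act h y) -> r y (act (h ^+ k)%g y).
  move=> yh; elim: k => [|k IHk].
    by rewrite expg0 actG.1; case: (r_total y y).
  by rewrite expgS actG.2; apply: r_trans yh _; exact: r_act.
have hx_z : r (act h x) (act (h ^+ n.+1)%g x).
  by rewrite expgS (actG.2 h); apply: r_act; exact: hX.
(* The return point [z = h^(n+1) x] satisfies [h x <= z <= h y < y]. Then [f z < f y = h x <= z],
   against [z <= f z]. *)
pose y := act g x.
have hy : ~ r y (act h y) by rewrite hE.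
have hyn k : r (act (h ^+ k)%g (act h y)) (act h y).
  elim: k => [|k IHk]; first by rewrite expg0 actG.1;
    case: (r_total (act h y) (act h y)).
  rewrite expgS actG.2; apply: (r_trans (r_act h IHk)); apply: r_act.
  by case: (r_total y (act h y)).
have z_hy : r (act (h ^+ n.+1)%g x) (act h y).
  apply: (r_trans (r_act _ xg)).
  by rewrite expgSr actG.2; exact: hyn.
have zy : ~ r y (act (h ^+ n.+1)%g x) by move=> /r_trans /(_ z_hy).
have := r_lt f _ _ zy; rewrite -hE; apply.
exact: r_trans hx_z zf.
Qed.

Variable U : set_system T.
Hypotheses (U_ultra : UltraFilter U) (U_full : forall A, m A = 1 -> U A).

Definition limit_order (a b : G) : Prop := U [set x | r (act a x) (act b x)].

Lemma limit_order_preorder : left_preorder limit_order.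
Proof.
split=> [a b|b a c ab bc|c a b]; rewrite /limit_order.
- have [|ba] := in_ultra_setVsetC [set x | r (act a x) (act b x)] U_ultra.
    by left.
  right; apply: filterS ba => x /= nab.
  by case: (r_total (act a x) (act b x)).
- by apply: filterS2 ab bc => x /=; exact: r_trans.
- by apply: filterS => x /= ab; rewrite !actG.2; exact: r_act.
Qed.

(** The points [x] for which [f] and [g] cross at [y x] form the preimage under [y] of a null set,
    so by invariance the complement has mean 1 and lies in [U]. *)
Lemma limit_order_crossing_free : crossing_free limit_order.
Proof.
move=> f g y yf yg; rewrite /limit_order.
have [//|bad] := in_ultra_setVsetC
  [set x | r (act (g * y)%g x) (act (f * (g * (g * y)))%g x)] U_ultra.
have [_ _ _ mG] := mean.
have := mean_crossing f g; rewrite -(mG y) => /mean_setC /U_full good.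
suff : U set0 by move=> /filter_ex[].
apply: filterS (filterI (filterI yf yg) (filterI bad good)) => x /= [[]].
by rewrite !actG.2 => h1 h2 [h3]; apply.
Qed.

End NullCrossings.

(** * Nontriviality of the limit order, and assembly on the orbit of [p] *)

Lemma ultra_pigeonhole (T : Type) (I : eqType) (U : set_system T) (l : seq I)
    (B : I -> set T) :
  UltraFilter U -> (forall x, exists2 i, i \in l & B i x) ->
  exists2 i, i \in l & U (B i).
Proof.
move=> UU lB; apply: contrapT => nB.
have : U [set x | forall i, i \in l -> ~ B i x].
  have : forall i, i \in l -> U (~` B i).
    move=> i il; have [UB|//] := in_ultra_setVsetC (B i) UU.
    by exfalso; apply: nB; exists i.
  elim: (l) => [_|i l' IHl lU]; first by apply: filterS filterT => x _ i.
  apply: filterS2 (lU i (mem_head _ _)) (IHl _) => [x xi xl j|j jl].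
    by rewrite inE => /orP[/eqP->//|]; exact: xl.
  by apply: lU; rewrite inE jl orbT.
by move=> /filter_ex[x xB]; have [i il /(xB i il)] := lB x.
Qed.

Theorem theorem1p2 (R : realType) (G : groupType) (act : G -> R -> R)
    (fgG : finitely_generated G)
    (act_homeo : acts_by_homeomorphisms act)
    (act_order : forall g : G, {homo act g : x y / x <= y})
    (p : R)
    (stab_proper : stabilizer act p `<` [set: G])
    (stab_coamenable : coamenable R (stabilizer act p)) :
  exists phi : G -> int,
    {morph phi : g h / (g * h)%g >-> g + h} /\
    set_surj [set: G] [set: int] phi.
Proof.
have [[act1 actM] _] := act_homeo.
have [A /finite_seqP[l Al] genl] := fgG; rewrite {}Al in genl.
(* Restricting to the orbit keeps the mean away from global fixed points, where all comparisons
   would be equalities. *)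
pose T := {x : R | exists g, act g p = x}.
have orbit_act g (x : T) : exists h, act h p = act g (sval x).
  by have [h hx] := svalP x; exists (g * h)%g; rewrite actM hx.
pose tact g (x : T) : T := exist _ _ (orbit_act g x).
have T_ext (x y : T) : sval x = sval y -> x = y.
  by case: x y => x hx [y hy] /= xy; subst y; congr exist; exact: Prop_irrelevance.
have tactG : group_action tact.
  by split=> [x|g h x]; apply: T_ext => /=; rewrite ?act1 ?actM.
have p_orbit : exists g, act g p = p by exists 1%g.
have [|m mean] := coamenable_mean (p := exist _ p p_orbit : T) tactG _ stab_coamenable.
  by move=> h hp; exact: T_ext.
have full_filter : ProperFilter [set A | m A = 1].
  have [m1 m0 mU _] := mean.
  apply: Build_ProperFilter_ex => [B /= B1|].
    apply: contrapT => /set0P/negP/negPn/eqP B0.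
    have : m (B `|` B) = m B + m B by rewrite mU ?B0 ?setI0.
    by rewrite setUid B1 => /eqP; rewrite -subr_eq subrr eq_sym oner_eq0.
  split=> //= [B C|B C BC B1]; first exact: (mean_setI mean).
  apply/eqP; rewrite eq_le (mean_le1 mean)/= -B1; exact: (mean_le mean BC).
have [U [U_ultra U_full]] := ultraFilterLemma full_filter.
pose r (x y : T) := sval x <= sval y.
pose r' (x y : T) := r y x.
have r_total x y : r x y \/ r y x by apply/orP; exact: le_total.
have r_trans y x z : r x y -> r y z -> r x z by exact: le_trans.
have r_act g x y : r x y -> r (tact g x) (tact g y) by exact: act_order.
apply: (@conradian_int_morphism R G (limit_order tact r U) l) => //.
- exact: limit_order_preorder.
- exact: (limit_order_crossing_free tactG mean).
(* The limit order of the flipped relation [r'] is, by conversion, the reverse of that of [r]. *)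
- apply: (limit_order_crossing_free tactG mean (r := r')) => //.
  + by move=> x y; exact: r_total.
  + by move=> y x z xy yz; exact: r_trans xy.
  + by move=> g x y; exact: r_act.
(* If all generators fixed [x = k p], so would every [k g k^-1]; hence every [g] would fix [p],
   against properness. *)
have moved (x : T) : exists2 a, a \in l & tact a x <> x.
  apply: contrapT => fixx; move: stab_proper => [_ /(_ _)]; apply => g _ /=.
  have fx h : act h (sval x) = sval x.
    have : smallest (@subgroup G) [set` l] h by rewrite genl.
    move=> /(_ [set h | act h (sval x) = sval x]); apply; split; last first.
      move=> a /= al; apply: contrapT => ax; apply: fixx; exists a => //.
      by move=> /(congr1 sval).
    split=> [|a b]; rewrite !inE /= ?act1// => ax bx.
    by rewrite actM -{1}bx -(actM b^-1%g) mulVg act1.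
  have [k kp] := svalP x.
  apply: (can_inj (g := act k^-1%g) (f := act k)).
    by move=> y; rewrite -actM mulVg act1.
  by rewrite -actM -[(k * g)%g](mulgVK k) actM kp fx.
(* A single generator moves [U]-almost every point, so by antisymmetry on the reals it is not
   equivalent to [1]. *)
have [a al Ua] := ultra_pigeonhole U_ultra moved.
exists a => // -[a1 a2]; suff : U set0 by move=> /filter_ex[].
apply: filterS (filterI Ua (filterI a1 a2)) => x /= [ax []].
rewrite tactG.1 => h1 h2; apply/ax/T_ext/eqP.
by rewrite eq_le; apply/andP.
Qed.
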